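(* Let $b,\alpha,\gamma\in\mathbb{C}$ with $b\neq 0$. There are nontrivial extensions of conformal $\mathcal{W}(b)$-modules of the form $$0\longrightarrow \mathbb{C}c_\gamma\longrightarrow E\longrightarrow M(\alpha,\Delta)\longrightarrow 0$$ (for some $\Delta\in\mathbb{C}$, $\Delta\neq 0$) if and only if $\alpha+\gamma=0$. Moreover, these nontrivial extensions are given, up to equivalence, by $E=\mathbb{C}c_\gamma\oplus\mathbb{C}[\partial]v_\Delta$ (direct sum of $\mathbb{C}[\partial]$-modules) with $$L_\lambda v_\Delta=(\partial+\alpha+\Delta\lambda)v_\Delta+f(\lambda)c_\gamma,\qquad H_\lambda v_\Delta=g(\lambda)c_\gamma,\qquad L_\lambda c_\gamma=H_\lambda c_\gamma=0,$$ where one of the following holds: (A) $g(\lambda)=0$, and either $\Delta=1$ and $f(\lambda)=c_2\lambda^2$ with $c_2\in\mathbb{C}$, $c_2\neq0$, or $\Delta=2$ and $f(\lambda)=c_3\lambda^3$ with $c_3\in\mathbb{C}$, $c_3\neq 0$ (this for every $0\neq b\in\mathbb{C}$); (B) $g(\lambda)=a$ for some $0\neq a\in\mathbb{C}$, $\Delta=b$, and $$f(\lambda)=\begin{cases} c_2\lambda^2, & b=1,\\ c_3\lambda^3, & b=2,\\ 0,&\text{otherwise,}\end{cases}$$ with $c_2,c_3\in\mathbb{C}$ arbitrary.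
   Context: For $b\in\mathbb{C}$, $\mathcal{W}(b)=\mathbb{C}[\partial]L\oplus\mathbb{C}[\partial]H$ is the free rank 2 Lie conformal algebra with $\lambda$-brackets $[L_\lambda L]=(\partial+2\lambda)L$, $[L_\lambda H]=(\partial+(1-b)\lambda)H$, $[H_\lambda H]=0$. A conformal module $M$ over a Lie conformal algebra $R$ is a $\mathbb{C}[\partial]$-module with a $\mathbb{C}$-linear map $R\to \mathrm{End}_{\mathbb{C}}(M)\otimes_{\mathbb{C}}\mathbb{C}[\lambda]$, $a\mapsto a_\lambda$, such that $a_\lambda b_\mu-b_\mu a_\lambda=[a_\lambda b]_{\lambda+\mu}$ and $(\partial a)_\lambda=[\partial,a_\lambda]=-\lambda a_\lambda$ for all $a,b\in R$; in particular $a_\lambda(\partial v)=(\partial+\lambda)a_\lambda v$. For $b\ne0$ and $\alpha,\Delta\in\mathbb{C}$ with $\Delta\neq0$, $M(\alpha,\Delta)=\mathbb{C}[\partial]v_\Delta$ is the $\mathcal{W}(b)$-module, free of rank one over $\mathbb{C}[\partial]$, with $L_\lambda v_\Delta=(\partial+\alpha+\Delta\lambda)v_\Delta$, $H_\lambda v_\Delta=0$. For $\gamma\in\mathbb{C}$, $\mathbb{C}c_\gamma$ is the one-dimensional $\mathcal{W}(b)$-module with $L_\lambda c_\gamma=H_\lambda c_\gamma=0$ and $\partial c_\gamma=\gamma c_\gamma$. An extension of $W$ by $V$ is an exact sequence of $R$-modules $0\to V\to E\to W\to0$. Two extensions $E,E'$ of $W$ by $V$ are equivalent if there is a module homomorphism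 $\psi:E\to E'$ which together with the identity maps of $V$ and $W$ gives a commutative diagram of exact sequences. An extension is trivial if it is equivalent to the direct sum $V\oplus W$, and nontrivial otherwise. *)

(* Defs.v *)
From HB Require Import structures.
From mathcomp Require Import all_boot all_order all_algebra.
From mathcomp Require Import ring.
From mathcomp Require Export reals complex.

Set Implicit Arguments.
Unset Strict Implicit.
Unset Printing Implicit Defensive.

Import GRing.Theory Num.Theory.
Local Open Scope ring_scope.

(* Encoding.  A C[d]-module is an [lmodType {poly C}]: the indeterminate 'X
   acts as d and the constant polynomials as scalars.  An element of
   C[lambda] (x) M is represented by the function C -> M which evaluates it at
   lambda; as C is infinite, such functions with a polynomial expression
   ([leval lambda%:P c] below) correspond bijectively to elements of
   C[lambda] (x) M, and identities in C[lambda, mu] (x) M can be tested at all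
   values of lambda and mu. *)

Section LieConformal.
Variable C : numFieldType.

(* Substitution of s in C[d] for lambda in \sum_i lambda^i c_i, where the powers
   of s act on the coefficients c_i. *)
Definition leval (M : lmodType {poly C}) (s : {poly C}) (c : seq M) : M :=
  \sum_(i < size c) s ^+ i *: c`_i.

Definition lpolynomial (M : lmodType {poly C}) (F : C -> M) : Prop :=
  exists c : seq M, forall l, F l = leval l%:P c.

(* [br l a b] is [a_l b].  The axiom [br_skew] also says that [a_lambda b] is
   polynomial in lambda; its second equation is
   [b_lambda a] = - [a_{- lambda - d} b]. *)
Record lie_conformal_axioms (R : lmodType {poly C}) (br : C -> R -> R -> R) :
    Prop := LieConformalAxioms {
  br_linl : forall l k a a' b,
    br l (k%:P *: a + a') b = k%:P *: br l a b + br l a' b;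
  br_linr : forall l k a b b',
    br l a (k%:P *: b + b') = k%:P *: br l a b + br l a b';
  br_dl : forall l a b, br l ('X *: a) b = - (l%:P *: br l a b);
  br_dr : forall l a b, br l a ('X *: b) = ('X + l%:P) *: br l a b;
  br_skew : forall a b, exists2 c : seq R,
    forall l, br l a b = leval l%:P c
    & forall l, br l b a = - leval (- l%:P - 'X) c;
  br_jacobi : forall l m a b c,
    br l a (br m b c) = br (l + m) (br l a b) c + br m b (br l a c)
}.

Record lieConformalAlgebra := LieConformalAlgebra {
  lca_carrier :> lmodType {poly C};
  lbr : C -> lca_carrier -> lca_carrier -> lca_carrier;
  lcaP : lie_conformal_axioms lbr
}.

(* [act l a v] is a_l v.  The map a_lambda sends M to C[lambda] (x) M; the
   degree in lambda of a_lambda v may depend on v. *)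
Record conf_module_axioms (R : lieConformalAlgebra) (M : lmodType {poly C})
    (act : C -> R -> M -> M) : Prop := ConfModuleAxioms {
  act_linl : forall l k a a' v,
    act l (k%:P *: a + a') v = k%:P *: act l a v + act l a' v;
  act_linr : forall l k a v v',
    act l a (k%:P *: v + v') = k%:P *: act l a v + act l a v';
  act_poly : forall a v, lpolynomial (fun l => act l a v);
  act_br : forall l m a b v,
    act l a (act m b v) - act m b (act l a v) = act (l + m) (lbr l a b) v;
  act_dl : forall l a v, act l ('X *: a) v = - (l%:P *: act l a v);
  act_dr : forall l a v,
    'X *: act l a v - act l a ('X *: v) = - (l%:P *: act l a v)
}.

Record confModule (R : lieConformalAlgebra) := ConfModule {
  cm_carrier :> lmodType {poly C};
  cact : C -> R -> cm_carrier -> cm_carrier;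
  cmP : conf_module_axioms cact
}.

Definition is_module_hom (R : lieConformalAlgebra) (M N : confModule R)
    (h : {linear M -> N}) : Prop :=
  forall l a v, h (cact l a v) = cact l a (h v).

Record extension (R : lieConformalAlgebra) (V W : confModule R) := Extension {
  ext_mod :> confModule R;
  ext_in : {linear V -> ext_mod};
  ext_out : {linear ext_mod -> W};
  ext_in_hom : is_module_hom ext_in;
  ext_out_hom : is_module_hom ext_out;
  ext_in_inj : injective ext_in;
  ext_out_surj : forall w, exists e, ext_out e = w;
  ext_exact : forall e, ext_out e = 0 <-> exists v, ext_in v = e
}.

Definition ext_equiv (R : lieConformalAlgebra) (V W : confModule R)
    (E E' : extension V W) : Prop :=
  exists psi : {linear E -> E'},
    [/\ is_module_hom psi,
        forall v, psi (ext_in E v) = ext_in E' v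
      & forall e, ext_out E' (psi e) = ext_out E e].

Section Theory.
Variable R : lieConformalAlgebra.

Lemma levalE (M : lmodType {poly C}) (s : {poly C}) (c : seq M) n :
  (size c <= n)%N -> leval s c = \sum_(i < n) s ^+ i *: c`_i.
Proof.
move=> le_n; rewrite /leval (big_ord_widen n (fun i => s ^+ i *: c`_i)) //.
rewrite big_mkcond; apply: eq_bigr => i _; case: ltnP => // h.
by rewrite nth_default ?scaler0.
Qed.

Lemma lpolynomial_pair (M N : lmodType {poly C}) (F : C -> M) (G : C -> N) :
  lpolynomial F -> lpolynomial G ->
  lpolynomial (fun l => (F l, G l) : (M * N)%type).
Proof.
move=> [c Fc] [d Gd]; pose n := maxn (size c) (size d).
exists (mkseq (fun i => (c`_i, d`_i) : (M * N)%type) n) => l.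
rewrite Fc Gd (@levalE M _ c n) ?leq_maxl // (@levalE N _ d n) ?leq_maxr //.
rewrite (@levalE _ _ _ n) ?size_mkseq //.
rewrite (eq_bigr (fun i : 'I_n => (l%:P ^+ i *: c`_i, l%:P ^+ i *: d`_i)));
  last by move=> i _; rewrite nth_mkseq.
by elim/big_rec3: _ => // i x y z _ <-.
Qed.

Section Acts.
Variables (M : lmodType {poly C}) (act : C -> R -> M -> M).
Hypothesis hM : conf_module_axioms act.

Lemma actDl l a a' v : act l (a + a') v = act l a v + act l a' v.
Proof. by have := act_linl hM l 1 a a' v; rewrite !scale1r. Qed.

Lemma actDr l a v v' : act l a (v + v') = act l a v + act l a v'.
Proof. by have := act_linr hM l 1 a v v'; rewrite !scale1r. Qed.

Lemma act0l l v : act l 0 v = 0.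
Proof. by apply: (addrI (act l 0 v)); rewrite -actDl !addr0. Qed.

Lemma act0r l a : act l a 0 = 0.
Proof. by apply: (addrI (act l a 0)); rewrite -actDr !addr0. Qed.

Lemma actZl l p a v : act l (p *: a) v = (p.[- l])%:P *: act l a v.
Proof.
elim/poly_ind: p => [|p k IH]; first by rewrite horner0 !scale0r act0l.
rewrite hornerMXaddC polyCD polyCM !scalerDl addrC (act_linl hM) addrC.
congr (_ + _); rewrite [p * 'X]mulrC -(scalerA 'X) (act_dl hM) IH scalerA -scaleNr.
by rewrite polyCN mulrN mulrC.
Qed.

Lemma act_drE l a v : act l a ('X *: v) = ('X + l%:P) *: act l a v.
Proof.
move/eqP: (act_dr hM l a v); rewrite subr_eq addrC => /eqP AB.
by rewrite scalerDl AB subrK.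
Qed.

Lemma actZr l a p v : act l a (p *: v) = (p \Po ('X + l%:P)) *: act l a v.
Proof.
elim/poly_ind: p => [|p k IH]; first by rewrite comp_poly0 !scale0r act0r.
rewrite comp_poly_MXaddC !scalerDl addrC (act_linr hM) addrC.
by congr (_ + _); rewrite [p * 'X]mulrC -(scalerA 'X) act_drE IH scalerA mulrC.
Qed.

End Acts.

Section DirectSum.
Variables V W : confModule R.

Definition dsum_act (l : C) (a : R) (e : V * W) : V * W :=
  (cact l a e.1, cact l a e.2).

Lemma dsum_axioms : conf_module_axioms dsum_act.
Proof.
split=> [l k a a' v|l k a v v'|a v|l m a b v|l a v|l a v]; rewrite /dsum_act.
- by rewrite !(act_linl (cmP _)).
- by rewrite !(act_linr (cmP _)).
- by apply: lpolynomial_pair; apply: (act_poly (cmP _)).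
- by rewrite -!(act_br (cmP _)).
- by rewrite !(act_dl (cmP _)).
- apply: (can_inj (@opprK _)); rewrite opprK.
  congr pair; apply: (can_inj (@opprK _)); rewrite opprK;
    exact: (act_dr (cmP _)).
Qed.

Definition dsum : confModule R := ConfModule dsum_axioms.

Definition dsum_in (v : V) : dsum := (v, 0).
Definition dsum_out (e : dsum) : W := e.2.

Lemma dsum_in_linear : linear dsum_in.
Proof. by move=> k v v'; congr pair; rewrite /= scaler0 addr0. Qed.
HB.instance Definition _ :=
  GRing.isLinear.Build {poly C} V dsum *:%R dsum_in dsum_in_linear.

Lemma dsum_out_linear : linear dsum_out. Proof. by []. Qed.
HB.instance Definition _ :=
  GRing.isLinear.Build {poly C} dsum W *:%R dsum_out dsum_out_linear.

Lemma dsum_in_hom : is_module_hom dsum_in.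
Proof. by move=> l a v; congr pair; rewrite /= (act0r (cmP _)). Qed.

Lemma dsum_out_hom : is_module_hom dsum_out. Proof. by []. Qed.

Lemma dsum_in_inj : injective dsum_in. Proof. by move=> v v' []. Qed.

Lemma dsum_out_surj w : exists e, dsum_out e = w.
Proof. by exists (0, w). Qed.

Lemma dsum_exact e : dsum_out e = 0 <-> exists v, dsum_in v = e.
Proof.
case: e => v w; split=> [/= w0|[v' <-]] //.
by exists v; rewrite /dsum_in -w0.
Qed.

Definition dsum_ext : extension V W :=
  Extension dsum_in_hom dsum_out_hom dsum_in_inj dsum_out_surj dsum_exact.

Definition ext_trivial (E : extension V W) : Prop := ext_equiv E dsum_ext.

End DirectSum.
End Theory.

Section Wb.
Variable b : C.

Local Notation Wcarrier := ({poly C}^o * {poly C}^o)%type.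

(* The element a.1 L + a.2 H is represented by (a.1, a.2).  The bracket is the
   sesquilinear extension of the brackets of the generators, where
   [H_lambda L] = ((1 - b) lambda - b d) H follows from [L_lambda H] by
   skew-symmetry. *)
Definition W_br (l : C) (a c : Wcarrier) : Wcarrier :=
  ((a.1.[- l])%:P * (c.1 \Po ('X + l%:P)) * ('X + (2 * l)%:P),
   (a.1.[- l])%:P * (c.2 \Po ('X + l%:P)) * ('X + ((1 - b) * l)%:P)
   + (a.2.[- l])%:P * (c.1 \Po ('X + l%:P)) * (((1 - b) * l)%:P - b%:P * 'X)).

Lemma leval_horner (P Q : {poly {poly C}}) (s : {poly C}) :
  leval s (mkseq (fun i => (P`_i, Q`_i) : Wcarrier) (maxn (size P) (size Q)))
  = (P.[s], Q.[s]).
Proof.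
rewrite (horner_coef_wide s (leq_maxl _ (size Q))).
rewrite (horner_coef_wide s (leq_maxr (size P) _)) /leval size_mkseq.
rewrite (eq_bigr (fun i : 'I_(maxn (size P) (size Q)) =>
    (s ^+ i *: (P`_i : {poly C}^o), s ^+ i *: (Q`_i : {poly C}^o))));
  last by move=> i _; rewrite nth_mkseq.
elim/big_rec3: _ => // i x y z _ ->.
by rewrite [_ * s ^+ i]mulrC [Q`_i * _]mulrC.
Qed.

Lemma horner_shift (p : {poly C}) l m :
  (p \Po ('X + l%:P)).[m] = p.[m + l].
Proof. by rewrite horner_comp !hornerE. Qed.

Lemma comp_shift (p : {poly C}) l m :
  (p \Po ('X + l%:P)) \Po ('X + m%:P) = p \Po ('X + (l + m)%:P).
Proof.
by rewrite -comp_polyA comp_polyD comp_polyX comp_polyC polyCD addrAC addrA.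
Qed.

Lemma W_axioms : lie_conformal_axioms W_br.
Proof.
split=> [l k a a' c|l k a c c'|l a c|l a c|a c|l m a c d].
- rewrite /W_br /= /GRing.scale /= !hornerD !hornerM !hornerC.
  by rewrite !polyCD !polyCM; congr pair; rewrite /= /GRing.scale /=; ring.
- rewrite /W_br /= !comp_polyD /GRing.scale /= !comp_polyM !comp_polyC.
  by congr pair; rewrite /= /GRing.scale /=; ring.
- rewrite /W_br /= /GRing.scale /= !hornerM !hornerX !polyCM !polyCN.
  by congr pair; rewrite /= /GRing.scale /=; ring.
- rewrite /W_br /= /GRing.scale /= !comp_polyM !comp_polyX.
  by congr pair; rewrite /= /GRing.scale /=; ring.
- pose E (p : {poly C}) : {poly {poly C}} := p^:P \Po (- 'X).
  pose S (p : {poly C}) : {poly {poly C}} := p^:P \Po ('X + 'X%:P).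
  have ES (p s : {poly C}) : (E p).[s] = p \Po (- s).
    by rewrite horner_comp !hornerE.
  have SS (p s : {poly C}) : (S p).[s] = p \Po ('X + s).
    by rewrite horner_comp !hornerE addrC.
  pose P := E a.1 * S c.1 * ('X%:P + 2%:P%:P * 'X).
  pose Q := E a.1 * S c.2 * ('X%:P + (1 - b)%:P%:P * 'X)
    + E a.2 * S c.1 * ((1 - b)%:P%:P * 'X - b%:P%:P * 'X%:P).
  exists (mkseq (fun i => (P`_i, Q`_i) : Wcarrier) (maxn (size P) (size Q))).
    move=> l; rewrite leval_horner /W_br /P /Q !(hornerE, ES, SS) -?polyCN.
    by rewrite !comp_polyCr !polyCM.
  move=> l; rewrite leval_horner /W_br /P /Q.
  rewrite !(hornerM, hornerD, hornerN, hornerX, hornerC, ES, SS).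
  have -> : - (- l%:P - 'X) = 'X + l%:P :> {poly C} by ring.
  have -> : 'X + (- l%:P - 'X) = (- l)%:P :> {poly C} by rewrite polyCN; ring.
  rewrite !comp_polyCr !polyCM !polyCB.
  by congr pair; rewrite /= /GRing.scale /=; ring.
- rewrite /W_br /= !(hornerM, hornerD, hornerN, hornerX, hornerC, horner_shift).
  rewrite !(comp_polyB, comp_polyD, comp_polyM, comp_polyC, comp_shift,
    comp_polyX).
  have -> : - (l + m) + l = - m by ring.
  rewrite [m + l]addrC !(polyCD, polyCM, polyCN, polyC1).
  by congr pair; rewrite /=; ring.
Qed.

Definition W : lieConformalAlgebra := LieConformalAlgebra W_axioms.

Definition W_L : W := (1, 0).
Definition W_H : W := (0, 1).

Lemma W_LL l : lbr l W_L W_L = ('X + (2 * l)%:P) *: W_L.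
Proof.
by congr pair; rewrite /= ?/GRing.scale /= !hornerC !comp_polyC; ring.
Qed.

Lemma W_LH l : lbr l W_L W_H = ('X + ((1 - b) * l)%:P) *: W_H.
Proof.
by congr pair; rewrite /= ?/GRing.scale /= !hornerC !comp_polyC; ring.
Qed.

Lemma W_HH l : lbr l W_H W_H = 0.
Proof.
by congr pair; rewrite /= ?/GRing.scale /= !hornerC !comp_polyC; ring.
Qed.

(* M(alpha, Delta); [p : {poly C}] represents p(d) v_Delta. *)
Section Mad.
Variables alpha Delta : C.

Definition Mad_act (l : C) (a : W) (p : {poly C}^o) : {poly C}^o :=
  (a.1.[- l])%:P * (p \Po ('X + l%:P)) * ('X + alpha%:P + (Delta * l)%:P).

Lemma Mad_axioms : conf_module_axioms Mad_act.
Proof.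
split=> [l k a a' p|l k a p p'|a p|l m a c p|l a p|l a p]; rewrite /Mad_act.
- rewrite /= /GRing.scale /= hornerD hornerM hornerC polyCD polyCM.
  by rewrite /GRing.scale /=; ring.
- by rewrite /GRing.scale /= comp_polyD comp_polyM comp_polyC; ring.
- pose P := (a.1^:P \Po (- 'X)) * (p^:P \Po ('X + 'X%:P))
    * ('X%:P + alpha%:P%:P + Delta%:P%:P * 'X).
  exists (P : seq {poly C}^o) => l; rewrite /leval.
  transitivity P.[l%:P].
    rewrite /P !(hornerM, hornerD, hornerN, hornerX, hornerC, horner_comp).
    by rewrite -polyCN [l%:P + 'X]addrC -!comp_polyCr polyCM.
  by rewrite horner_coef; apply: eq_bigr => i _; rewrite mulrC.
- rewrite /= /GRing.scale /= !(hornerM, hornerD, hornerN, hornerX, hornerC,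
    horner_shift).
  rewrite !(comp_polyB, comp_polyD, comp_polyM, comp_polyC, comp_shift,
    comp_polyX).
  have -> : - (l + m) + l = - m by ring.
  by rewrite [m + l]addrC !(polyCD, polyCM, polyCN, polyC1); ring.
- by rewrite /= /GRing.scale /= hornerM hornerX polyCM polyCN; ring.
- by rewrite /GRing.scale /= comp_polyM comp_polyX; ring.
Qed.

Definition Mad : confModule W := ConfModule Mad_axioms.
Definition Mad_v : Mad := 1.

Lemma Mad_L l : cact l W_L Mad_v = ('X + alpha%:P + (Delta * l)%:P) *: Mad_v.
Proof.
by rewrite /= /Mad_act /= hornerC comp_polyC !mul1r /GRing.scale /= mulr1.
Qed.

Lemma Mad_H l : cact l W_H Mad_v = 0.
Proof. by rewrite /= /Mad_act /= horner0 !mul0r. Qed.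

Lemma Mad_span (p : Mad) : p = p *: Mad_v.
Proof. by rewrite /GRing.scale /= mulr1. Qed.
End Mad.

(* C c_gamma; z : C represents z c_gamma. *)
Definition Cgam_sort (gamma : C) : Type := C.

Section Cgam.
Variable gamma : C.
HB.instance Definition _ := GRing.Zmodule.copy (Cgam_sort gamma) C.

Definition Cgam_scale (p : {poly C}) (z : Cgam_sort gamma) : Cgam_sort gamma :=
  p.[gamma] * (z : C).

Lemma Cgam_scaleA p q z : Cgam_scale p (Cgam_scale q z) = Cgam_scale (p * q) z.
Proof. by rewrite /Cgam_scale hornerM mulrA. Qed.
Lemma Cgam_scale1 : left_id 1 Cgam_scale.
Proof. by move=> z; rewrite /Cgam_scale hornerC mul1r. Qed.
Lemma Cgam_scaleDr : right_distributive Cgam_scale +%R.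
Proof. by move=> p z z'; rewrite /Cgam_scale mulrDr. Qed.
Lemma Cgam_scaleDl z : {morph Cgam_scale^~ z : p q / p + q}.
Proof. by move=> p q; rewrite /Cgam_scale hornerD mulrDl. Qed.
HB.instance Definition _ :=
  GRing.Zmodule_isLmodule.Build {poly C} (Cgam_sort gamma)
    Cgam_scaleA Cgam_scale1 Cgam_scaleDr Cgam_scaleDl.

Definition Cgam_act (l : C) (a : W) (z : Cgam_sort gamma) : Cgam_sort gamma := 0.

Lemma Cgam_axioms : conf_module_axioms Cgam_act.
Proof.
split=> *; rewrite /Cgam_act ?scaler0 ?addr0 ?subr0 ?oppr0 //.
by exists [::] => l; rewrite /leval big_ord0.
Qed.

Definition Cgam : confModule W := ConfModule Cgam_axioms.
Definition Cgam_c : Cgam := (1 : C).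

Lemma Cgam_d : 'X *: Cgam_c = gamma%:P *: Cgam_c.
Proof. by rewrite /GRing.scale /= /Cgam_scale hornerX hornerC. Qed.
End Cgam.

Lemma W_gen (a : W) : a = a.1 *: W_L + a.2 *: W_H.
Proof.
by case: a => a1 a2; congr pair; rewrite /= /GRing.scale /=
  ?mulr1 ?mulr0 ?addr0 ?add0r.
Qed.

Section StdExt.
Variables (alpha gamma Delta : C) (f g : {poly C}).

Local Notation Ecarrier := (Cgam gamma * Mad alpha Delta)%type.
Local Notation c := ((Cgam_c gamma, 0) : Ecarrier).
Local Notation v := ((0, Mad_v alpha Delta) : Ecarrier).

(* [act] makes C c_gamma (+) C[d] v_Delta a module through the formulas
   determined by f and g; these fix [act] on all of W(b) by C-linearity and
   sesquilinearity. *)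
Record std_axioms (act : C -> W -> Ecarrier -> Ecarrier) : Prop := StdAxioms {
  std_module : conf_module_axioms act;
  std_Lv : forall l, act l W_L v =
    ('X + alpha%:P + (Delta * l)%:P) *: v + (f.[l])%:P *: c;
  std_Hv : forall l, act l W_H v = (g.[l])%:P *: c;
  std_Lc : forall l, act l W_L c = 0;
  std_Hc : forall l, act l W_H c = 0
}.

Variable act : C -> W -> Ecarrier -> Ecarrier.
Hypothesis hact : std_axioms act.

Definition std_mod : confModule W := ConfModule (std_module hact).

Definition std_in (z : Cgam gamma) : std_mod := (z, 0).
Definition std_out (e : std_mod) : Mad alpha Delta := e.2.

Lemma std_in_linear : linear std_in.
Proof. by move=> k z z'; congr pair; rewrite /= scaler0 addr0. Qed.
HB.instance Definition _ :=
  GRing.isLinear.Build {poly C} (Cgam gamma) std_mod *:%R std_in std_in_linear.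

Lemma std_out_linear : linear std_out. Proof. by []. Qed.
HB.instance Definition _ :=
  GRing.isLinear.Build {poly C} std_mod (Mad alpha Delta) *:%R
    std_out std_out_linear.

Lemma std_inE z : std_in z = z%:P *: c :> Ecarrier.
Proof.
congr pair; rewrite /= ?scaler0 //.
by rewrite /GRing.scale /= /Cgam_scale hornerC /Cgam_c mulr1.
Qed.

Lemma std_c0 l a : act l a c = 0.
Proof.
rewrite (W_gen a) (actDl (std_module hact)) !(actZl (std_module hact)).
by rewrite (std_Lc hact) (std_Hc hact) !scaler0 addr0.
Qed.

Lemma std_in_hom : is_module_hom std_in.
Proof.
move=> l a z; rewrite -[RHS]/(act l a (std_in z)) (std_inE z).
by rewrite (actZr (std_module hact)) std_c0 scaler0.
Qed.

Lemma std_out_hom : is_module_hom std_out.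
Proof.
move=> l a [z p]; rewrite /std_out /=.
have -> : (z, p) = std_in z + p *: v :> Ecarrier.
  by congr pair; rewrite /= ?scaler0 ?addr0 // add0r -Mad_span.
rewrite (actDr (std_module hact)) std_inE !(actZr (std_module hact)) std_c0.
rewrite scaler0 add0r {1}(W_gen a) (actDl (std_module hact)).
rewrite !(actZl (std_module hact)) (std_Lv hact) (std_Hv hact) /=.
rewrite /Mad_act /Mad_v /= !scaler0 !addr0 /GRing.scale /= !mulr1.
by ring.
Qed.

Lemma std_in_inj : injective std_in. Proof. by move=> z z' []. Qed.

Lemma std_out_surj w : exists e, std_out e = w.
Proof. by exists (0, w). Qed.

Lemma std_exact e : std_out e = 0 <-> exists z, std_in z = e.
Proof.
case: e => z w; split=> [/= w0|[z' <-]] //.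
by exists z; rewrite /std_in -w0.
Qed.

Definition std_ext : extension (Cgam gamma) (Mad alpha Delta) :=
  Extension std_in_hom std_out_hom std_in_inj std_out_surj std_exact.

End StdExt.

Definition caseA (Delta : C) (f g : {poly C}) : Prop :=
  g = 0 /\
  ((Delta = 1 /\ exists c2 : C, c2 != 0 /\ f = c2 *: 'X^2) \/
   (Delta = 2 /\ exists c3 : C, c3 != 0 /\ f = c3 *: 'X^3)).

Definition caseB (Delta : C) (f g : {poly C}) : Prop :=
  (exists a : C, a != 0 /\ g = a%:P) /\ Delta = b /\
  exists c2 c3 : C,
    f = if b == 1 then c2 *: 'X^2 else if b == 2 then c3 *: 'X^3 else 0.

End Wb.
End LieConformal.

(* Main.v *)
From HB Require Import structures.
Require Import Defs.
From mathcomp Require Import all_boot all_order all_algebra.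
From mathcomp Require Import ring.
From mathcomp Require Import reals complex.

Set Implicit Arguments.
Unset Strict Implicit.
Unset Printing Implicit Defensive.

Import GRing.Theory Num.Theory.
Local Open Scope ring_scope.

(* A lift v of v_Delta to an extension E splits E over C[d], with
   L_l v = (d + alpha + Delta l) v + f(l) c and H_l v = g(l) c, and E is determined
   up to equivalence by (f, g).  With s = alpha + gamma, the module axioms amount
   to the two functional equations
     (s + l + Delta m) f(l) - (s + m + Delta l) f(m) = (l - m) f(l + m),
     (s + m + Delta l) g(m) = (m + b l) g(l + m),
   and replacing v by v + k c subtracts k (s + Delta l) from f.  If s <> 0,
   putting m = 0 in the first equation makes f a multiple of s + Delta l, and
   l = 0 in the second gives g = 0, so that E is trivial.  If s = 0, then g is a
   constant a with (Delta - b) a = 0, and the coefficients of f are found by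
   differentiating the first equation once and twice in l at l = 0. *)

(** * Transfer of identities between polynomials and their values *)

Lemma horner_inj (C : numDomainType) (p q : {poly C}) :
  (forall x, p.[x] = q.[x]) -> p = q.
Proof.
move=> pq; apply/eqP; rewrite -subr_eq0; apply/negPn/negP => nz.
(* In characteristic zero the naturals below [size (p - q)] are distinct: one root more than the
   degree allows. *)
have := max_poly_roots nz (rs := [seq i%:R | i <- iota 0 (size (p - q))]).
rewrite size_map size_iota ltnn => H; apply: notF; apply: H.
  by apply/allP => x _; rewrite /root !hornerE pq subrr.
rewrite map_inj_uniq ?iota_uniq // => i j /eqP.
by rewrite eqr_nat => /eqP.
Qed.

(** Lets [ring] deduce one equation from another: the side condition is a pure ring identity. *)
Lemma eq_by_sub (V : zmodType) (x y z t : V) :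
  x = y -> z - t = x - y -> z = t.
Proof. by move=> -> /eqP; rewrite subrr subr_eq0 => /eqP. Qed.

(** * Polynomial solutions of the two functional equations *)

Section Cocycles.
Variables (C : numFieldType) (b alpha gamma Delta : C).

Definition Lcocycle (f : {poly C}) : Prop := forall l m,
  (alpha + gamma + l + Delta * m) * f.[l]
  - (alpha + gamma + m + Delta * l) * f.[m] = (l - m) * f.[l + m].

Definition Hcocycle (g : {poly C}) : Prop := forall l m,
  (alpha + gamma + m + Delta * l) * g.[m] = (m + b * l) * g.[l + m].

Section Solve.
Hypothesis s0 : alpha + gamma = 0.
Hypothesis Delta0 : Delta != 0.

(** For s = 0 and m = 0 the equation reads Delta l g(0) = b l g(l). Cancelling b l makes g constant,
    and a nonzero constant then gives Delta = b. *)
Lemma Hcocycle_const g : b != 0 -> Hcocycle g ->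
  exists2 a : C, g = a%:P & a != 0 -> Delta = b.
Proof.
move=> hb hg; have [a ga] : exists a : C, g = a%:P.
  (* Cancelling ['X] among polynomials, not its values, also covers x = 0. *)
  exists (Delta / b * g.[0]); apply: (@mulfI _ 'X); first by rewrite polyX_eq0.
  apply: horner_inj => x; rewrite hornerM [RHS]hornerM hornerC !hornerX.
  have := hg x 0; rewrite s0 !add0r addr0 => h.
  apply: (mulfI hb); rewrite mulrA -h; field; exact: hb.
exists a => // a0; have := hg 1 0; rewrite s0 ga !hornerE => h.
exact: (mulIf a0).
Qed.

(* The two equations are the first and second derivatives of the cocycle
   equation in [l] at [l = 0]. *)
Lemma Lcocycle_deriv f : Lcocycle f ->
  f.[0] = 0 /\ forall m : C,
    m * f^`().[m] - (1 + Delta) * f.[m] + Delta * f^`().[0] * m = 0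
    /\ 2 * f^`().[m] - m * f^`()^`().[m]
       = 2 * f^`().[0] + Delta * f^`()^`().[0] * m.
Proof.
move=> hf; have f0 : f.[0] = 0.
  (* At l = 1, m = 0 only Delta f(0) = 0 remains. *)
  have := hf 1 0; rewrite s0 !mulr0 !addr0 !add0r mulr1 subr0 => /eqP.
  rewrite mul1r subr_eq addrC -subr_eq subrr eq_sym mulf_eq0 (negPf Delta0).
  by move/eqP.
split=> // m.
(* [P] and [Q] are the two sides as polynomials in l for fixed m, so that they can be
   differentiated. *)
pose P := ('X + (Delta * m)%:P) * f - (m%:P + Delta *: 'X) * (f.[m])%:P.
pose Q := ('X - m%:P) * (f \Po ('X + m%:P)).
have PQ : P = Q.
  apply: horner_inj => l; have := hf l m; rewrite s0 !add0r.
  by rewrite /P /Q !(hornerE, horner_comp).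
split.
  have := congr1 (fun p : {poly C} => p^`().[0]) PQ; rewrite /P /Q.
  rewrite !(derivE, deriv_comp) !(hornerE, horner_comp) f0 => h.
  apply: (eq_by_sub h) => /=; ring.
have := congr1 (fun p : {poly C} => p^`()^`().[0]) PQ; rewrite /P /Q.
rewrite !(derivE, deriv_comp) !(hornerE, horner_comp) => h.
by apply: (eq_by_sub (esym h)) => /=; ring.
Qed.

(** The first-derivative equation alone would allow degree i + 2 whenever Delta = i + 1; the second
    kills all degrees above 3. The linear coefficient stays free, since for s = 0 a multiple of l is
    a coboundary. *)
Lemma Lcocycle_form f : Lcocycle f ->
  exists c1 c2 c3 : C, [/\ f = c1 *: 'X + c2 *: 'X^2 + c3 *: 'X^3,
    c2 != 0 -> Delta = 1 & c3 != 0 -> Delta = 2].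
Proof.
move=> /Lcocycle_deriv [f0 hf].
have E1 : 'X * f^`() - (1 + Delta) *: f + (Delta * f^`().[0]) *: 'X = 0.
  by apply: horner_inj => m; rewrite !hornerE; case: (hf m).
have E2 : f^`() *+ 2 - 'X * f^`()^`()
    = (2 * f^`().[0])%:P + (Delta * f^`()^`().[0]) *: 'X.
  by apply: horner_inj => m; rewrite !hornerE; case: (hf m) => _ <-; ring.
have F1 i : f`_i.+2 * (1 + i%:R - Delta) = 0.
  have := congr1 (fun p : {poly C} => p`_i.+2) E1.
  rewrite !(coef_deriv, coefB, coefD, coefXM, coefZ, coefX, coef0) /= => h.
  by apply: (eq_by_sub h) => /=; ring.
have F2 i : f`_i.+3 * (i%:R * (3 + i%:R)) = 0.
  have := congr1 (fun p : {poly C} => p`_i.+2) E2.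
  rewrite !(coef_deriv, coefB, coefD, coefMn, coefXM, coefZ, coefX, coefC) /=.
  move=> h; apply: (eq_by_sub (esym h)) => /=; ring.
exists f`_1, f`_2, f`_3; split.
- apply/polyP => -[|[|[|[|i]]]]; rewrite !coefE /= ?mulr0 ?mulr1 ?addr0 ?add0r //.
    by rewrite -horner_coef0.
  move/eqP: (F2 i.+1); rewrite !mulf_eq0 -natrD !pnatr_eq0 orbF.
  by move/eqP.
- by move=> n0; move/eqP: (F1 0%N); rewrite mulf_eq0 (negPf n0) addr0 subr_eq0 => /eqP.
- by move=> n0; move/eqP: (F1 1%N); rewrite mulf_eq0 (negPf n0) subr_eq0 => /eqP.
Qed.

End Solve.

Lemma Lcocycle_trivial f l : Lcocycle f ->
  (alpha + gamma) * f.[l] = (alpha + gamma + Delta * l) * f.[0].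
Proof. by move=> /(_ l 0); rewrite mulr0 !addr0 => /eq_by_sub; apply; ring. Qed.

Lemma Hcocycle_trivial g m : Hcocycle g -> (alpha + gamma) * g.[m] = 0.
Proof.
by move=> /(_ 0 m); rewrite !mulr0 !addr0 add0r => /eq_by_sub; apply; ring.
Qed.

End Cocycles.

Lemma Cgam_scaleE (C : numFieldType) (gamma : C) (p : {poly C})
  (z : Cgam_sort gamma) : p *: z = p.[gamma] * (z : C).
Proof. by []. Qed.

(** * The module structure defined by a pair of cocycles *)

Section CocycleModule.
Variables (C : numFieldType) (b alpha gamma Delta : C) (f g : {poly C}).

Local Notation V := (Cgam b gamma).
Local Notation M := (Mad b alpha Delta).

(* The coefficient of c_gamma in a_l (p v_Delta). *)
Definition cocycle_pair_act (l : C) (a : W b) (p : {poly C}) : C :=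
  p.[gamma + l] * (a.1.[- l] * f.[l] + a.2.[- l] * g.[l]).

Definition cocycle_act (l : C) (a : W b) (e : V * M) : V * M :=
  (cocycle_pair_act l a e.2, cact l a e.2).

Hypothesis hf : Lcocycle alpha gamma Delta f.
Hypothesis hg : Hcocycle b alpha gamma Delta g.

Lemma cocycle_pair_act_poly (a : W b) (p : {poly C}) :
  lpolynomial (fun l => cocycle_pair_act l a p : V).
Proof.
pose P := (p \Po (gamma%:P + 'X))
  * ((a.1 \Po (- 'X)) * f + (a.2 \Po (- 'X)) * g).
exists (P : seq (Cgam_sort gamma)) => l; rewrite /leval.
transitivity (P.[l] : Cgam_sort gamma).
  by rewrite /P !(hornerM, hornerD, hornerN, hornerX, hornerC, horner_comp).
rewrite horner_coef; apply: eq_bigr => i _.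
by rewrite Cgam_scaleE horner_exp hornerC mulrC.
Qed.

(** Up to the common factor p(gamma + l + m), both sides are bilinear in the values of the
    components of a at -l and of c at -m. The (L, L) coefficient is the equation for f, the (L, H)
    and (H, L) ones are the equation for g at (l, m) and (m, l), and the (H, H) one vanishes. *)
Lemma cocycle_pair_act_br l m (a c : W b) (p : {poly C}) :
  cocycle_pair_act l a (Mad_act alpha Delta m c p)
  - cocycle_pair_act m c (Mad_act alpha Delta l a p)
  = cocycle_pair_act (l + m) (lbr l a c) p.
Proof.
rewrite /cocycle_pair_act /Mad_act /=.
rewrite !(hornerM, hornerD, hornerN, hornerX, hornerC, horner_comp).
have -> : - (l + m) + l = - m by ring.
rewrite (_ : gamma + m + l = gamma + l + m); last by ring.
rewrite (_ : gamma + (l + m) = gamma + l + m); last by ring.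
have := hf l m; have := hg l m; have := hg m l; rewrite [m + l]addrC.
move=> h1 h2 h3.
set A := _.[- l]; set B := _.[- l]; set Q := p.[_].
set A' := _.[- m]; set B' := _.[- m].
have H : Q * (A * A' * ((l - m) * f.[l + m])
    - A * B' * ((m + b * l) * g.[l + m])
    + B * A' * ((l + b * m) * g.[l + m]))
  = Q * (A * A' * ((alpha + gamma + l + Delta * m) * f.[l]
        - (alpha + gamma + m + Delta * l) * f.[m])
    - A * B' * ((alpha + gamma + m + Delta * l) * g.[m])
    + B * A' * ((alpha + gamma + l + Delta * m) * g.[l])).
  by rewrite h1 h2 h3.
by apply: (eq_by_sub (esym H)); ring.
Qed.

Lemma cocycle_axioms : conf_module_axioms cocycle_act.
Proof.
split=> [l k a a' e|l k a e e'|a e|l m a c e|l a e|l a e]; rewrite /cocycle_act.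
- rewrite (act_linl (cmP _)); congr pair.
  rewrite -[RHS]/(_ + _) /= Cgam_scaleE /cocycle_pair_act /GRing.scale /=.
  by rewrite !(hornerD, hornerM, hornerC); ring.
- rewrite (act_linr (cmP _)); congr pair.
  rewrite -[RHS]/(_ + _) /= Cgam_scaleE /cocycle_pair_act /GRing.scale /=.
  by rewrite !(hornerD, hornerM, hornerC); ring.
- apply: lpolynomial_pair; last exact: (act_poly (cmP _)).
  exact: cocycle_pair_act_poly.
- rewrite -(act_br (cmP _)); congr pair.
  exact: cocycle_pair_act_br.
- rewrite (act_dl (cmP _)); congr pair.
  rewrite -[RHS]/(- _) /= Cgam_scaleE /cocycle_pair_act /GRing.scale /=.
  by rewrite !(hornerM, hornerX, hornerC); ring.
- apply: (can_inj (@opprK _)); rewrite opprK.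
  congr pair; apply: (can_inj (@opprK _)); rewrite opprK;
    last exact: (act_dr (cmP _)).
  rewrite -[LHS]/(_ - _) /= !Cgam_scaleE /cocycle_pair_act /GRing.scale /=.
  by rewrite !(hornerM, hornerX, hornerC); ring.
Qed.

Lemma cocycle_std_axioms : @std_axioms C b alpha gamma Delta f g cocycle_act.
Proof.
split=> [|l|l|l|l]; first exact: cocycle_axioms.
- rewrite -[LHS]/(_, _); congr pair; last first.
    by rewrite /= scaler0 addr0; exact: Mad_L.
  rewrite /= scaler0 add0r Cgam_scaleE /cocycle_pair_act /= !hornerC /Cgam_c.
  by rewrite !mul1r mul0r addr0 mulr1.
- rewrite -[LHS]/(_, _); congr pair; last by rewrite /= scaler0; exact: Mad_H.
  rewrite /= Cgam_scaleE /cocycle_pair_act /= !hornerC /Cgam_c.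
  by rewrite !mul1r mul0r add0r mulr1.
- rewrite /cocycle_act (act0r (cmP _)); congr pair.
  by rewrite /cocycle_pair_act horner0 mul0r.
- rewrite /cocycle_act (act0r (cmP _)); congr pair.
  by rewrite /cocycle_pair_act horner0 mul0r.
Qed.

End CocycleModule.

(** * Extensions in coordinates given by a lift of [v_Delta] *)

Section ExtensionData.
Variables (C : numFieldType) (b alpha gamma Delta : C).

Local Notation V := (Cgam b gamma).
Local Notation M := (Mad b alpha Delta).

Record ext_data (E : extension V M) (v : E) (f g : {poly C}) : Prop :=
  ExtData {
  ext_data_out : ext_out E v = Mad_v b alpha Delta;
  ext_data_L : forall l, cact l (W_L b) v =
    ('X + alpha%:P + (Delta * l)%:P) *: v + ext_in E (f.[l] : C);
  ext_data_H : forall l, cact l (W_H b) v = ext_in E (g.[l] : C)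
}.

Lemma ext_out_in (E : extension V M) z : ext_out E (ext_in E z) = 0.
Proof. by apply/ext_exact; exists z. Qed.

Section Coordinate.
Variables (E : extension V M) (v : E).
Hypothesis hv : ext_out E v = Mad_v b alpha Delta.

Lemma ext_outZ (p : {poly C}) : ext_out E (p *: v) = p.
Proof. by rewrite linearZ /= hv /Mad_v /GRing.scale /= mulr1. Qed.

(** Exactness gives the coordinate; the boolean equality is what [xchoose] requires. *)
Lemma ext_coord_subproof (e : E) :
  exists z : V, ext_in E z == e - (ext_out E e : {poly C}) *: v.
Proof.
have [z zE] : exists z, ext_in E z = e - (ext_out E e : {poly C}) *: v.
  by apply/ext_exact; rewrite linearB /= ext_outZ subrr.
by exists z; apply/eqP.
Qed.

Definition ext_coord (e : E) : V := xchoose (ext_coord_subproof e).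

Lemma ext_decomp e : e = ext_in E (ext_coord e) + (ext_out E e : {poly C}) *: v.
Proof. by rewrite (eqP (xchooseP (ext_coord_subproof e))) subrK. Qed.

Lemma ext_decomp_inj z z' (p p' : {poly C}) :
  ext_in E z + p *: v = ext_in E z' + p' *: v -> z = z' /\ p = p'.
Proof.
move=> zz'; have pp' : p = p'.
  have := congr1 (ext_out E) zz'.
  by rewrite !linearD /= !ext_out_in !ext_outZ !add0r.
by move: zz'; rewrite pp' => /addIr /ext_in_inj ->.
Qed.

Lemma ext_coordE z (p : {poly C}) : ext_coord (ext_in E z + p *: v) = z.
Proof. by have /esym/ext_decomp_inj [] := ext_decomp (ext_in E z + p *: v). Qed.

Lemma ext_coord_linear : linear ext_coord.
Proof.
move=> k e e'; rewrite {1}(ext_decomp e) {1}(ext_decomp e') scalerDr addrACA.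
by rewrite scalerA -scalerDl -!linearZ -linearD ext_coordE.
Qed.
HB.instance Definition _ :=
  GRing.isLinear.Build {poly C} E V *:%R ext_coord ext_coord_linear.

Section To.
Variables (E' : extension V M) (v' : E').

(** The candidate equivalence: the identity in coordinates, sending the lift [v] to [v']. *)
Definition ext_to (e : E) : E' :=
  ext_in E' (ext_coord e) + (ext_out E e : {poly C}) *: v'.

Lemma ext_to_linear : linear ext_to.
Proof.
move=> k e e'; rewrite /ext_to !linearP scalerDl scalerDr scalerA.
by rewrite addrACA.
Qed.
HB.instance Definition _ :=
  GRing.isLinear.Build {poly C} E E' *:%R ext_to ext_to_linear.

Lemma ext_toE z (p : {poly C}) :
  ext_to (ext_in E z + p *: v) = ext_in E' z + p *: v'.
Proof. by rewrite /ext_to ext_coordE linearD /= ext_out_in add0r ext_outZ. Qed.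

End To.

Lemma ext_data_exists : exists f g, ext_data v f g.
Proof.
have coordP (a : W b) :
    exists f : {poly C}, forall l, ext_coord (cact l a v) = f.[l].
  have [c cE] := act_poly (cmP E) a v.
  (* The coordinate is taken coefficientwise; powers of l are constants of C[d] and act on [c_gamma]
     as scalars. *)
  exists (\poly_(i < size c) (ext_coord c`_i : C)) => l.
  rewrite cE /leval linear_sum horner_poly; apply: eq_bigr => i _.
  by rewrite linearZ /= Cgam_scaleE horner_exp hornerC mulrC.
have [f fE] := coordP (W_L b); have [g gE] := coordP (W_H b).
exists f, g; split=> // l.
  rewrite {1}(ext_decomp (cact l _ v)) fE ext_out_hom hv Mad_L addrC.
  by congr (_ *: _ + _); rewrite /GRing.scale /= mulr1.
by rewrite {1}(ext_decomp (cact l _ v)) gE ext_out_hom hv Mad_H scale0r addr0.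
Qed.

End Coordinate.

(** By sesquilinearity the data (f, g) fix the whole action, which is that of the cocycle module. *)
Lemma ext_data_act (E : extension V M) (v : E) f g l a z (p : {poly C}) :
  ext_data v f g ->
  cact l a (ext_in E z + p *: v)
  = ext_in E (cocycle_pair_act gamma f g l a p)
    + Mad_act alpha Delta l a p *: v.
Proof.
case=> _ vL vH; rewrite (actDr (cmP E)) -ext_in_hom linear0 add0r.
rewrite (actZr (cmP E)) {1}(W_gen a) (actDl (cmP E)) !(actZl (cmP E)) vL vH.
rewrite !scalerDr !scalerA -addrA addrC -!linearZ /= -linearD /=.
congr (ext_in E _ + _ *: v); last first.
  by rewrite /Mad_act; ring.
rewrite !Cgam_scaleE /cocycle_pair_act.
rewrite !(hornerM, hornerD, hornerX, hornerC, horner_comp).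
rewrite -[LHS]/(_ + _ : C); ring.
Qed.

Lemma ext_data_cocycle (E : extension V M) (v : E) f g :
  ext_data v f g ->
  Lcocycle alpha gamma Delta f /\ Hcocycle b alpha gamma Delta g.
Proof.
move=> hd; have K l m (a c : W b) :
    cocycle_pair_act gamma f g l a (Mad_act alpha Delta m c 1)
    - cocycle_pair_act gamma f g m c (Mad_act alpha Delta l a 1)
    = cocycle_pair_act gamma f g (l + m) (lbr l a c) 1.
  (* The argument is the lift itself, written in coordinates; the [c_gamma] coordinates are then
     compared. *)
  have := act_br (cmP E) l m a c (ext_in E 0 + 1 *: v).
  rewrite !(ext_data_act _ _ _ _ hd) opprD addrACA -linearB -scalerBl.
  by case/(ext_decomp_inj (ext_data_out hd)).
split=> l m.
- have := K l m (W_L b) (W_L b); rewrite W_LL.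
  rewrite /cocycle_pair_act /Mad_act /=.
  rewrite !(hornerM, hornerD, hornerN, hornerX, hornerC, horner_comp) => h.
  by apply: (eq_by_sub h); ring.
- have := K l m (W_L b) (W_H b); rewrite W_LH.
  rewrite /cocycle_pair_act /Mad_act /=.
  rewrite !(hornerM, hornerD, hornerN, hornerX, hornerC, horner_comp) => h.
  by apply: (eq_by_sub (esym h)); ring.
Qed.

(** L kills [c_gamma], but rewriting (d + alpha + Delta l) v through the new lift costs k (gamma +
    alpha + Delta l) c_gamma. *)
Lemma ext_data_shift (E : extension V M) (v : E) f g (k : C) :
  ext_data v f g ->
  ext_data (v + ext_in E (k : V))
    (f - k *: ((alpha + gamma)%:P + Delta *: 'X)) g.
Proof.
case=> vo vL vH; split=> [|l|l]; first by rewrite linearD /= ext_out_in addr0.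
- rewrite (actDr (cmP E)) -ext_in_hom linear0 addr0 vL scalerDr -[RHS]addrA.
  congr (_ + _); rewrite -linearZ /= -linearD /=; congr (ext_in E _).
  rewrite Cgam_scaleE !(hornerD, hornerN, hornerZ, hornerX, hornerC).
  by rewrite -[RHS]/(_ + _ : C); ring.
- by rewrite (actDr (cmP E)) -ext_in_hom linear0 addr0.
Qed.

Lemma ext_equiv_data (E E' : extension V M) (v : E) (v' : E') f g :
  ext_data v f g -> ext_data v' f g -> ext_equiv E E'.
Proof.
move=> hd hd'; pose hv := ext_data_out hd.
exists (ext_to hv v'); split=> [l a e|z|e].
- rewrite (ext_decomp hv e) (ext_data_act _ _ _ _ hd) /= !ext_toE.
  by rewrite (ext_data_act _ _ _ _ hd').
- by rewrite -[ext_in E z]addr0 -(scale0r v) /= ext_toE scale0r addr0.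
- by rewrite /= /ext_to linearD /= ext_out_in add0r ext_outZ // (ext_data_out hd').
Qed.

Lemma ext_data_transfer (E E' : extension V M) (v : E) f g :
  ext_equiv E E' -> ext_data v f g -> exists v' : E', ext_data v' f g.
Proof.
case=> psi [psi_hom psi_in psi_out] [vo vL vH]; exists (psi v).
split=> [|l|l]; first by rewrite psi_out.
  by rewrite -psi_hom vL linearD linearZ /= psi_in.
by rewrite -psi_hom vH psi_in.
Qed.

Lemma dsum_data : exists v : dsum_ext V M, ext_data v 0 0.
Proof.
exists ((0, Mad_v b alpha Delta) : dsum V M); split=> [//|l|l].
- rewrite horner0 linear0 addr0 -[LHS]/(_, _) Mad_L; congr pair.
  by rewrite /= scaler0.
- by rewrite horner0 linear0 -[LHS]/(_, _) Mad_H.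
Qed.

Lemma ext_data0_trivial (E : extension V M) (v : E) :
  ext_data v 0 0 -> ext_trivial E.
Proof. by have [v' hv'] := dsum_data => hv; apply: ext_equiv_data hv hv'. Qed.

Lemma ext_trivial_data (E : extension V M) (v : E) f g :
  ext_trivial E -> ext_data v f g ->
  g = 0 /\ exists k : C, f = k *: ((alpha + gamma)%:P + Delta *: 'X).
Proof.
move=> /ext_data_transfer tr /tr [[k p] [po pL pH]]; split.
  apply: horner_inj => l; rewrite horner0.
  exact: (esym (congr1 fst (pH l))).
(* The transported lift is (k, p), and W(b) acts by zero on its first coordinate; hence f(l) = -k (s
   + Delta l). *)
exists (- (k : C)); apply: horner_inj => l.
have h : 0 = ('X + alpha%:P + (Delta * l)%:P).[gamma] * (k : C) + f.[l].
  exact: (congr1 fst (pL l)).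
apply: (eq_by_sub (esym h)).
by rewrite !(hornerD, hornerZ, hornerX, hornerC); ring.
Qed.

Lemma std_ext_data f g act
    (h : @std_axioms C b alpha gamma Delta f g act) :
  exists v : std_ext h, ext_data v f g.
Proof.
exists ((0, Mad_v b alpha Delta) : std_mod h); split=> [//|l|l].
- rewrite -[LHS]/(act l _ _) (std_Lv h); congr (_ + _).
  by rewrite -(std_inE h).
- by rewrite -[LHS]/(act l _ _) (std_Hv h) -(std_inE h).
Qed.

End ExtensionData.

(** * Normal forms of nontrivial extensions *)

Section Classification.
Variables (C : numFieldType) (b alpha gamma Delta : C).
Hypotheses (b_neq0 : b != 0) (Delta_neq0 : Delta != 0).

Local Notation V := (Cgam b gamma).
Local Notation M := (Mad b alpha Delta).

Lemma ext_resonance (E : extension V M) :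
  ~ ext_trivial E -> alpha + gamma = 0.
Proof.
move=> nt; apply/eqP/negPn/negP => s0; apply: nt.
have [v hv] := ext_out_surj E (Mad_v b alpha Delta).
have [f [g hd]] := ext_data_exists hv; have [hf hg] := ext_data_cocycle hd.
have g0 : g = 0.
  apply: horner_inj => l; apply: (mulfI s0).
  by rewrite (Hcocycle_trivial _ hg) horner0 mulr0.
(* As s is invertible, f is the coboundary with k = f(0) / s, which a shift of the lift removes. *)
have fE : f = (f.[0] / (alpha + gamma)) *: ((alpha + gamma)%:P + Delta *: 'X).
  apply: horner_inj => l; apply: (mulfI s0); rewrite (Lcocycle_trivial _ hf).
  by rewrite !(hornerD, hornerZ, hornerX, hornerC); field.
have := ext_data_shift (f.[0] / (alpha + gamma)) hd.
by rewrite -fE subrr g0 => /ext_data0_trivial.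
Qed.

Lemma ext_normal_form (E : extension V M) : ~ ext_trivial E ->
  exists f g, exists2 v : E, ext_data v f g
    & caseA Delta f g \/ caseB b Delta f g.
Proof.
move=> nt; have s0 := ext_resonance nt.
have [v hv] := ext_out_surj E (Mad_v b alpha Delta).
have [f [g hd]] := ext_data_exists hv; have [hf hg] := ext_data_cocycle hd.
have [a gE aD] := Hcocycle_const s0 b_neq0 hg.
have [c1 [c2 [c3 [fE D1 D2]]]] := Lcocycle_form s0 Delta_neq0 hf.
(* As s = 0, this shift removes exactly the linear term c1 l. *)
have := ext_data_shift (c1 / Delta) hd; move: (v + _) => w.
have -> : f - (c1 / Delta) *: ((alpha + gamma)%:P + Delta *: 'X)
    = c2 *: 'X^2 + c3 *: 'X^3.
  by rewrite fE s0 add0r scalerA divfK // addrC -[c1 *: _ + _ + _]addrA addKr.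
move=> hw; exists (c2 *: 'X^2 + c3 *: 'X^3), g, w => //.
have n12 : 1 <> 2 :> C by move/eqP; rewrite (eqr_nat C 1 2).
have c2c3 : c2 != 0 -> c3 = 0.
  move=> /D1 D; apply/eqP/negPn/negP => /D2 D'; apply: n12.
  exact: etrans (esym D) D'.
have [a0|an0] := eqVneq a 0.
  left; rewrite gE a0; split=> //.
  have [z2|n2] := eqVneq c2 0; last first.
    left; split; first exact: D1.
    by exists c2; rewrite (c2c3 n2) scale0r addr0.
  have [z3|n3] := eqVneq c3 0; last first.
    right; split; first exact: D2.
    by exists c3; rewrite z2 scale0r add0r.
  (* With a, c2 and c3 all zero the extension would split. *)
  case: nt; apply: (@ext_data0_trivial _ _ _ _ _ _ w).
  by move: hw; rewrite z2 z3 !scale0r addr0 gE a0.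
right; split; first by exists a.
have Db := aD an0; split=> //; exists c2, c3.
have nz (c d : C) : (c != 0 -> Delta = d) -> b != d -> c = 0.
  by move=> cd bd; apply/eqP/negPn/negP => /cd D; rewrite -Db D eqxx in bd.
case: ifPn => [/eqP b1|b1].
  rewrite (nz c3 2) ?scale0r ?addr0 // b1.
  by apply/eqP.
rewrite (nz c2 1) // scale0r add0r; case: ifPn => // b2.
by rewrite (nz c3 2) // scale0r.
Qed.

Hypothesis s0 : alpha + gamma = 0.

Lemma normal_form_cocycle f g : caseA Delta f g \/ caseB b Delta f g ->
  Lcocycle alpha gamma Delta f /\ Hcocycle b alpha gamma Delta g.
Proof.
have L0 : Lcocycle alpha gamma Delta 0.
  by move=> l m; rewrite !horner0 !mulr0 subr0.
have L1 c : Delta = 1 -> Lcocycle alpha gamma Delta (c *: 'X^2).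
  by move=> -> l m; rewrite s0 !(hornerZ, hornerXn); ring.
have L2 c : Delta = 2 -> Lcocycle alpha gamma Delta (c *: 'X^3).
  by move=> -> l m; rewrite s0 !(hornerZ, hornerXn); ring.
case=> [[-> ff]|[[a [_ ->]] [Db [c2 [c3 ->]]]]]; split.
- by case: ff => [[D [c [_ ->]]]|[D [c [_ ->]]]]; [exact: L1 | exact: L2].
- by move=> l m; rewrite !horner0 !mulr0.
- case: ifPn => [/eqP b1|_]; first by apply: L1; rewrite Db.
  by case: ifPn => [/eqP b2|_] //; apply: L2; rewrite Db.
- by move=> l m; rewrite !hornerC s0 Db add0r.
Qed.

(** Splitting would force g = 0, excluding (B), and f to be a multiple of l as s = 0, excluding the
    nonzero monomials of degree 2 or 3 in (A). *)
Lemma normal_form_nontrivial (E : extension V M) (v : E) f g :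
  ext_data v f g -> caseA Delta f g \/ caseB b Delta f g -> ~ ext_trivial E.
Proof.
move=> hd fg /ext_trivial_data /(_ hd) [g0 [k]]; rewrite s0 add0r scalerA.
case: fg => [[_]|[[a [a0 ga]] _]]; last first.
  by move: a0; rewrite -polyC_eq0 -ga g0 eqxx.
have cf (c d : C) n : (1 < n)%N -> c != 0 -> c *: 'X^n <> d *: 'X :> {poly C}.
  move=> n1 c0 /(congr1 (fun p : {poly C} => p`_n)).
  rewrite !(coefZ, coefXn, coefX) eqxx mulr1 gtn_eqF // mulr0 => cz.
  by rewrite cz eqxx in c0.
by case=> [[_ [c [c0 ->]]]|[_ [c [c0 ->]]]]; apply: cf.
Qed.

End Classification.

Theorem theorem3p2 (R : realType) (b alpha gamma : R[i]) (hb : b != 0) :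
  ((exists Delta : R[i], Delta != 0 /\
      exists E : extension (Cgam b gamma) (Mad b alpha Delta),
        ~ ext_trivial E)
   <-> alpha + gamma = 0)
  /\ (forall Delta : R[i], Delta != 0 ->
      forall E : extension (Cgam b gamma) (Mad b alpha Delta),
      ~ ext_trivial E ->
      exists (f g : {poly R[i]}) act
             (h : @std_axioms R[i] b alpha gamma Delta f g act),
        (caseA Delta f g \/ caseB b Delta f g) /\ ext_equiv E (std_ext h))
  /\ (alpha + gamma = 0 ->
      forall (Delta : R[i]) (f g : {poly R[i]}), Delta != 0 ->
      caseA Delta f g \/ caseB b Delta f g ->
      (exists act, @std_axioms R[i] b alpha gamma Delta f g act)
      /\ forall act (h : @std_axioms R[i] b alpha gamma Delta f g act),
           ~ ext_trivial (std_ext h)).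
Proof.
split; [split|split].
- by case=> Delta [D0 [E nt]]; apply: ext_resonance nt.
(* Delta = 1 with f = l^2 and g = 0 is available for every b. *)
- move=> s0; exists 1; split; first exact: oner_neq0.
  have fg : caseA 1 (1 *: 'X^2 : {poly R[i]}) 0.
    by split=> //; left; split=> //; exists 1; split; first exact: oner_neq0.
  have fg' := or_introl (caseB b 1 (1 *: 'X^2 : {poly R[i]}) 0) fg.
  have [hf hg] := normal_form_cocycle s0 fg'.
  exists (std_ext (cocycle_std_axioms hf hg)).
  have [v hv] := std_ext_data (cocycle_std_axioms hf hg).
  exact: (normal_form_nontrivial s0 hv fg').
- move=> Delta D0 E nt; have [f [g [v hd fg]]] := ext_normal_form hb D0 nt.
  have [hf hg] := ext_data_cocycle hd.
  exists f, g, (cocycle_act f g), (cocycle_std_axioms hf hg); split=> //.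
  have [v' hd'] := std_ext_data (cocycle_std_axioms hf hg).
  exact: ext_equiv_data hd hd'.
- move=> s0 Delta f g D0 fg; have [hf hg] := normal_form_cocycle s0 fg; split.
    by exists (cocycle_act f g); apply: cocycle_std_axioms.
  move=> act h; have [v hv] := std_ext_data h.
  exact: (normal_form_nontrivial s0 hv fg).
Qed.
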